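(* Let $d\ge 3$ and let $T$ be the infinite $d$-regular tree with origin $o$. If all rotors initially point in direction $d-1$, then every chip in an infinite succession of chips started at the origin and performing rotor-router walk eventually returns to the origin.
   Context: Rotor directions: at each vertex $v\neq o$ the $d$ neighbors are indexed by $\{1,\ldots,d\}$, with direction $d$ pointing to the parent (the neighbor closer to $o$) and directions $1,\dots,d-1$ pointing to the children; at $o$ the $d$ neighbors are indexed by $\{1,\ldots,d\}$ in some order. Rotors cycle through the indices in order $1,2,\ldots,d,1,\ldots$. Rotor-router walk: when a chip is at $v$, the rotor at $v$ first advances to the next direction, and then the chip moves to the neighbor in that direction. Chips are started at $o$ one after another; each walks until it first returns to $o$, where it stops. Rotors are not reset between chips: each chip starts with the rotor configuration left by the previous chip. *)

(* Defs.v *)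
From mathcomp Require Import all_boot.
Set Implicit Arguments.
Unset Strict Implicit.
Unset Printing Implicit Defensive.

Section Graphs.
Variables (V : eqType) (e : rel V).

(* As in path.v, a walk [x :: p] is given by its head [x] and its tail [p], so
   that [size p] is its number of edges. *)
Definition walk_between (x y : V) (p : seq V) : Prop :=
  path e x p /\ last x p = y.

Definition simple_path_between (x y : V) (p : seq V) : Prop :=
  walk_between x y p /\ uniq (x :: p).

Definition is_tree : Prop :=
  [/\ symmetric e, irreflexive e
    & forall x y, exists! p, simple_path_between x y p].

Definition is_regular (d : nat) : Prop :=
  forall v, exists s : seq V, [/\ uniq s, size s = d & s =i e v].

Definition is_dist (x y : V) (n : nat) : Prop :=
  (exists2 p, walk_between x y p & size p = n) /\
  (forall p, walk_between x y p -> n <= size p).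

Definition closer (o u v : V) : Prop :=
  exists m n, [/\ is_dist o u m, is_dist o v n & m < n].

End Graphs.

(* Directions 1, ..., d are represented by the ordinals 0, ..., d - 1. *)
Definition dir (d : nat) (i : 'I_d) : nat := i.+1.

(* [nbr v i] is the neighbor of [v] in direction [dir i]; the indexing at the
   origin [o] and the order of the children of the other vertices are
   arbitrary. *)
Definition is_indexing (d : nat) (V : eqType) (e : rel V) (o : V)
    (nbr : V -> 'I_d -> V) : Prop :=
  [/\ forall v, injective (nbr v),
      forall v w, e v w <-> exists i, nbr v i = w,
      forall v i, v != o -> dir i = d -> closer e o (nbr v i) v
    & forall v i, v != o -> dir i < d -> closer e o v (nbr v i)].

Section RotorRouter.
Variables (d : nat) (V : eqType) (nbr : V -> 'I_d -> V) (o : V).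

Definition rotor_config : Type := V -> 'I_d.

(* [ordS] is cyclic: direction d is followed by direction 1. *)
Definition advance (rho : rotor_config) (v : V) : rotor_config :=
  fun w => if w == v then ordS (rho v) else rho w.

Definition rotor_step (s : rotor_config * V) : rotor_config * V :=
  let: (rho, v) := s in
  let rho' := advance rho v in (rho', nbr v (rho' v)).

Definition rotor_walk (rho : rotor_config) (t : nat) : rotor_config * V :=
  iter t rotor_step (rho, o).

Definition first_return (rho : rotor_config) (t : nat) : Prop :=
  [/\ 0 < t, (rotor_walk rho t).2 = o
    & forall s, 0 < s < t -> (rotor_walk rho s).2 <> o].

(* [rho n] is the configuration found by the n-th chip (counting from 0); the
   next chip is started only once the n-th has returned. As the walk is
   deterministic, at most one sequence [rho] satisfies these conditions, and
   one exists exactly when every chip returns. *)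
Definition every_chip_returns (rho0 : rotor_config) : Prop :=
  exists rho : nat -> rotor_config,
    rho 0 = rho0 /\
    forall n, exists2 t, first_return (rho n) t
                       & rho n.+1 = (rotor_walk (rho n) t).1.

End RotorRouter.

(* Main.v *)
Require Import Defs.
From mathcomp Require Import all_boot.
Set Implicit Arguments.
Unset Strict Implicit.
Unset Printing Implicit Defensive.

(** Call [n] the state of the branch below a vertex [v] when its vertices at
    depth less than [n] have their rotor in direction [d] and all others have it
    in direction [d - 1]; initially every branch is in state [0]. A chip entering
    a branch in state [0] is sent straight back to the parent, which leaves state
    [1]. A chip entering a branch in state [n + 1] visits every child branch, all
    in state [n], exactly once and then leaves to the parent; by induction these
    visits are finite and raise the states of the child branches to [n + 1], so
    that the branch itself ends in state [n + 2]. *)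

Section Closer.
Variables (V : eqType) (e : rel V) (o : V).

Lemma is_dist_unique v m n : is_dist e o v m -> is_dist e o v n -> m = n.
Proof.
move=> [[p wp <-] minp] [[q wq <-] minq]; apply/eqP.
by rewrite eqn_leq minp // minq.
Qed.

Lemma closer_trans u v w : closer e o u v -> closer e o v w -> closer e o u w.
Proof.
move=> [m [n [um vn mn]]] [n' [k [vn' wk nk]]].
exists m, k; split => //; apply: ltn_trans mn _.
by rewrite (is_dist_unique vn vn').
Qed.

Lemma closer_irrefl v : ~ closer e o v v.
Proof. by move=> [m [n [vm vn]]]; rewrite (is_dist_unique vm vn) ltnn. Qed.

Lemma is_dist_origin : is_dist e o o 0.
Proof. by split=> //; exists [::]. Qed.

Lemma closer_neq_origin u v : closer e o u v -> v != o.
Proof.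
move=> [m [n [_ vn mn]]]; apply/eqP => vo; subst v.
by rewrite (is_dist_unique vn is_dist_origin) in mn.
Qed.

Lemma closer_origin v : irreflexive e -> e o v -> closer e o o v.
Proof.
move=> irr ov; exists 0, 1; split => //; first exact: is_dist_origin.
split; first by exists [:: v] => //; split; rewrite //= ov.
by move=> [|x p] // [_ /= ve]; move: ov; rewrite -ve irr.
Qed.

End Closer.

Section Visits.
Variables (d : nat) (V : eqType) (nbr : V -> 'I_d -> V) (o : V).

(** Only the states before the end must avoid [o], so that segments concatenate and a segment may
    end with the return to [o]. *)
Definition leads_to (x y : rotor_config d V * V) : Prop :=
  exists2 t, iter t (rotor_step nbr) x = y
           & forall s, s < t -> (iter s (rotor_step nbr) x).2 != o.

Lemma leads_to_refl x : leads_to x x.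
Proof. by exists 0. Qed.

Lemma leads_to_trans x y z : leads_to x y -> leads_to y z -> leads_to x z.
Proof.
move=> [t xy nt] [u yz nu]; exists (u + t); first by rewrite iterD xy.
move=> s lts; have [/nt //|le_ts] := ltnP s t.
by rewrite -(subnK le_ts) iterD xy nu // ltn_subLR // addnC.
Qed.

Lemma leads_to_step x : x.2 != o -> leads_to x (rotor_step nbr x).
Proof. by move=> xo; exists 1 => // -[]. Qed.

End Visits.

Section Branches.
Variables (d : nat) (V : eqType) (e : rel V) (o : V) (nbr : V -> 'I_d -> V).
Hypotheses (d_gt1 : 1 < d) (sym_e : symmetric e) (irr_e : irreflexive e).
Hypothesis nbr_indexing : is_indexing e o nbr.

Let nbr_inj v : injective (nbr v). Proof. by case: nbr_indexing. Qed.

Definition down_dir (i : 'I_d) : bool := dir i < d.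

(** All directions at the origin lead away from it, so branches at [o] and below other vertices are
    treated alike. *)
Definition child_dir (v : V) (i : 'I_d) : Prop := v = o \/ down_dir i.

Lemma closer_child v i : child_dir v i -> closer e o v (nbr v i).
Proof.
have [_ adj _ down] := nbr_indexing.
have [-> _|vo [/eqP|lid]] := eqVneq v o; last exact: down.
  by apply: closer_origin => //; apply/adj; exists i.
by rewrite (negPf vo).
Qed.

(** Adjacency is symmetric, so some direction [k] leads from the child back to [v]. A downward [k]
    would put [v] farther from [o] than itself, and [d] is the only other direction. *)
Lemma parent_child v i j :
  child_dir v i -> dir j = d -> nbr (nbr v i) j = v.
Proof.
move=> vi jd; have cl := closer_child vi; have co := closer_neq_origin cl.
have [_ adj _ down] := nbr_indexing.
have : e (nbr v i) v by rewrite sym_e; apply/adj; exists i.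
case/adj => k kv; have [kd|kd] := ltnP (dir k) d.
  by have := down _ _ co kd; rewrite kv => /(closer_trans cl)/closer_irrefl.
suff -> : j = k by [].
apply/val_inj/eqP; rewrite -eqSS -/(dir j) -/(dir k) jd.
by rewrite eqn_leq kd ltn_ord.
Qed.

Lemma descend_closer v i s :
  child_dir v i -> all down_dir s -> closer e o v (foldl nbr (nbr v i) s).
Proof.
move=> vi; elim/last_ind: s => [|s j IHs]; first by move=> _; exact: closer_child.
rewrite all_rcons foldl_rcons => /andP[dj /IHs cl].
by apply: closer_trans cl _; apply: closer_child; right.
Qed.

(** Stepping to the parent strips the last direction off both addresses at once. If one address runs
    out first, [v] would lie strictly below itself; if both do, injectivity of [nbr v] applies. *)
Lemma branches_disjoint v i j s1 s2 :
    child_dir v i -> child_dir v j -> all down_dir s1 -> all down_dir s2 ->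
  foldl nbr (nbr v i) s1 = foldl nbr (nbr v j) s2 -> i = j.
Proof.
move=> vi vj.
have ld : d.-1 < d by rewrite prednK // ltnW.
pose top := Ordinal ld; have topd : dir top = d by rewrite /dir prednK // ltnW.
have up u k : down_dir k -> nbr (nbr u k) top = u.
  by move=> dk; apply: parent_child => //; right.
elim/last_ind: s1 s2 => [|s1 a IHs] s2; case/lastP: s2 => [|s2 b];
  rewrite ?all_rcons ?foldl_rcons /=.
- by move=> _ _ /nbr_inj.
- move=> _ /andP[db ds2] /(congr1 (nbr^~ top)) /=.
  rewrite (parent_child vi topd) up //.
  by have := descend_closer vj ds2 => /[swap] <- /closer_irrefl.
- move=> /andP[da ds1] _ /(congr1 (nbr^~ top)) /=.
  rewrite (parent_child vj topd) up //.
  by have := descend_closer vi ds1 => /[swap] -> /closer_irrefl.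
move=> /andP[da ds1] /andP[db ds2] /(congr1 (nbr^~ top)) /=.
by rewrite !up //; exact: IHs.
Qed.

Definition in_branch (v w : V) : Prop :=
  exists2 s, all down_dir s & w = foldl nbr v s.

(** A vertex of the branch is addressed by a word [s] of downward directions, whose length is its
    depth below [v]. *)
Definition branch_state (n : nat) (v : V) (rho : rotor_config d V) : Prop :=
  forall s, all down_dir s ->
  dir (rho (foldl nbr v s)) = if size s < n then d else d.-1.

Lemma branch_state_ext n v rho rho' :
    (forall w, in_branch v w -> rho' w = rho w) ->
  branch_state n v rho -> branch_state n v rho'.
Proof. by move=> eq_rho st s ds; rewrite eq_rho ?st //; exists s. Qed.

Lemma not_in_child_branch v i : child_dir v i -> ~ in_branch (nbr v i) v.
Proof.
move=> vi [s ds vE]; have := descend_closer vi ds.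
by rewrite -vE => /closer_irrefl.
Qed.

Lemma child_in_branch v i w :
  down_dir i -> in_branch (nbr v i) w -> in_branch v w.
Proof. by move=> di [s ds ->]; exists (i :: s); rewrite //= di. Qed.

Lemma branch_state_advance n v i rho : child_dir v i ->
  branch_state n (nbr v i) rho -> branch_state n (nbr v i) (advance rho v).
Proof.
move=> vi; apply: branch_state_ext => w wi; rewrite /advance.
by case: eqP wi => // -> /(not_in_child_branch vi).
Qed.

(** The last clause serves the induction: a visit to one child branch leaves the rotor at [v] and
    the sibling branches as they were. *)
Lemma branch_visit n v j rho :
    v != o -> dir j = d -> branch_state n v rho ->
  exists rho', [/\ leads_to nbr o (rho, v) (rho', nbr v j),
                   branch_state n.+1 v rho'
                 & forall w, ~ in_branch v w -> rho' w = rho w].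
Proof.
elim: n v j rho => [|n IHn] v j rho vo jd st.
  exists (advance rho v); split.
  - have := leads_to_step nbr (x := (rho, v)) vo.
    rewrite /= /advance eqxx; suff -> : ordS (rho v) = j by [].
    (* Direction [d - 1] is the ordinal [d - 2], so [ordS] yields [d - 1], which is direction [d],
       without wrapping around. *)
    apply/val_inj/eqP; rewrite -eqSS -[X in _ == X]/(dir j) jd /=.
    have := st [::] isT; rewrite /dir /= => ->.
    by rewrite modn_small prednK // ltnW.
  - move=> [_|i s /= /andP[di ds]].
      rewrite /= /advance eqxx; have := st [::] isT; rewrite /dir /= => ->.
      by rewrite modn_small prednK // ltnW.
    (* Vertices strictly below [v] keep direction [d - 1], as state 1 requires at positive depth. *)
    have := @descend_closer v i s (or_intror di) ds.
    rewrite /advance; case: eqP => [->/closer_irrefl//|_ _].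
    by have := st (i :: s); rewrite /= di => ->.
  - move=> w nw; rewrite /advance; case: eqP => // wv; case: nw.
    by rewrite wv; exists [::].
(* Invariant after the visits to the first [k] children: the chip is back at [v], the next turn of
   the rotor selects the ordinal [k], and exactly the visited branches have gained one state. For
   [k = 0] the rotor at [v] is in direction [d] and wraps around. *)
have children k : k < d -> exists rho',
    [/\ leads_to nbr o (rho, v) (rho', v), ordS (rho' v) = k :> nat,
        forall i, down_dir i -> branch_state (n + (i < k)) (nbr v i) rho'
      & forall w, ~ in_branch v w -> rho' w = rho w].
  elim: k => [_|k IHk lk].
    exists rho; split=> //; first exact: leads_to_refl.
      by have := st [::] isT; rewrite /dir /= => ->; rewrite modnn.
    by move=> i di s ds; rewrite addn0; have := st (i :: s); rewrite /= di => ->.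
  have [rho1 [lead1 rot1 st1 out1]] := IHk (ltnW lk).
  pose i := Ordinal (ltnW lk); have di : down_dir i by [].
  have vi : child_dir v i by right.
  have rot_i : ordS (rho1 v) = i by apply: val_inj.
  (* The chip now stands at child [i], whose branch is still in state [n]; direction [d] there
     brings it back to [v]. *)
  have [||rho2 [lead2 st2 out2]] := IHn (nbr v i) j (advance rho1 v) _ jd.
  - exact: closer_neq_origin (closer_child vi).
  - apply: branch_state_advance => //; have := st1 i di.
    by rewrite ltnn addn0.
  have rho2v : rho2 v = i.
    rewrite out2; last exact: not_in_child_branch.
    by rewrite /advance eqxx.
  exists rho2; split.
  - apply: leads_to_trans lead1 _.
    apply: leads_to_trans (leads_to_step _ (x := (rho1, v)) vo) _.
    rewrite /= {2}/advance eqxx rot_i.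
    by move: lead2; rewrite parent_child.
  - by rewrite rho2v /= modn_small.
  - move=> l dl; have [->|neq_li] := eqVneq l i; first by rewrite ltnS leqnn addn1.
    have -> : (l < k.+1) = (l < k).
      by rewrite ltnS leq_eqVlt (_ : _ == k = false) //; apply: negPf neq_li.
    have vl : child_dir v l by right.
    apply: branch_state_ext (branch_state_advance vl (st1 l dl)).
    move=> w [s ds ->]; apply: out2 => -[s' ds' eqw].
    by case/eqP: neq_li; apply: branches_disjoint eqw.
  - move=> w nw; rewrite out2; last by move/(child_in_branch di).
    rewrite /advance; case: eqP nw => [-> []|_ /out1 //].
    by exists [::].
(* For [k = d - 1] every child has been visited, and the next turn selects direction [d], towards
   the parent. *)
have ld : d.-1 < d by rewrite prednK // ltnW.
have [rho1 [lead1 rot1 st1 out1]] := children _ ld.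
have rot_j : ordS (rho1 v) = j.
  by apply/val_inj/succn_inj; rewrite [X in X.+1 = _]rot1 prednK // ltnW.
exists (advance rho1 v); split.
- apply: leads_to_trans lead1 _.
  have := leads_to_step nbr (x := (rho1, v)) vo.
  by rewrite /= {2}/advance eqxx rot_j.
- move=> [_|i s /= /andP[di ds]]; first by rewrite /= /advance eqxx rot_j.
  have vi : child_dir v i by right.
  rewrite (branch_state_advance vi (st1 i di)) //.
  have -> : i < d.-1 by rewrite -ltnS prednK // ltnW.
  by rewrite addn1 ltnS.
- move=> w nw; rewrite /advance; case: eqP nw => [-> []|_ /out1 //].
  by exists [::].
Qed.

(** The state may differ from branch to branch, since each chip visits a single branch at [o] and
    raises only its state. *)
Definition origin_state (rho : rotor_config d V) : Prop :=
  forall i, exists n, branch_state n (nbr o i) rho.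

Lemma origin_state_return rho : origin_state rho ->
  exists2 t, first_return nbr o rho t & origin_state (rotor_walk nbr o rho t).1.
Proof.
move=> st; pose i := ordS (rho o); have ch k : child_dir o k by left.
have ld : d.-1 < d by rewrite prednK // ltnW.
pose top := Ordinal ld; have topd : dir top = d by rewrite /dir prednK // ltnW.
have [n /(branch_state_advance (ch i)) sti] := st i.
have io : nbr o i != o := closer_neq_origin (closer_child (ch i)).
have [rho' [[t tE t_o] st' out']] := branch_visit io topd sti.
have walkS s : rotor_walk nbr o rho s.+1 =
    iter s (rotor_step nbr) (advance rho o, nbr o i).
  by rewrite /rotor_walk iterSr /= {2}/advance eqxx.
(* The extra unit of time is the step out of [o]; the visit itself ends at the parent of [nbr o i],
   which is [o]. *)
exists t.+1; last first.
  rewrite walkS tE /= => j; have [->|neq_ji] := eqVneq j i; first by exists n.+1.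
  have [m /(branch_state_advance (ch j)) stj] := st j; exists m.
  apply: branch_state_ext stj => w [s ds ->]; apply: out' => -[s' ds' eqw].
  by case/eqP: neq_ji; apply: branches_disjoint eqw.
split=> //; first by rewrite walkS tE /= parent_child.
by move=> [//|s] lts; apply/eqP; rewrite walkS t_o.
Qed.

Lemma origin_state_recurrent rho0 :
  origin_state rho0 -> every_chip_returns nbr o rho0.
Proof.
(* A return time is known only to exist; taking the least one, for a decidable predicate, makes it a
   function that can be iterated. *)
move=> st0; pose returned rho t := (0 < t) && ((rotor_walk nbr o rho t).2 == o).
have returns rho : origin_state rho -> exists t, returned rho t.
  case/origin_state_return => t [t0 to _] _; exists t.
  by rewrite /returned t0 to eqxx.
pose time rho st := ex_minn (returns rho st).
have timeP rho st : first_return nbr o rho (time rho st) /\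
    origin_state (rotor_walk nbr o rho (time rho st)).1.
  have [t fr st'] := origin_state_return st; suff -> : time rho st = t by [].
  case: fr => t0 to tmin; rewrite /time; case: ex_minnP => u /andP[u0 /eqP uo] umin.
  apply/eqP; rewrite eqn_leq umin /=; last by rewrite /returned t0 to eqxx.
  by rewrite leqNgt; apply/negP => ut; apply: (tmin u) uo; rewrite u0.
(* The invariant is carried along with the configuration, so that the next chip can be started from
   it. *)
pose next (x : {rho | origin_state rho}) : {rho | origin_state rho} :=
  exist origin_state _ (timeP _ (proj2_sig x)).2.
exists (fun n => proj1_sig (iter n next (exist _ rho0 st0))); split=> // n.
set x := iter n next _.
by exists (time _ (proj2_sig x)); first by case: (timeP _ (proj2_sig x)).
Qed.

End Branches.

Theorem proposition4p4 (d : nat) (hd : 3 <= d)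
    (V : eqType) (e : rel V) (o : V)
    (hT : is_tree e) (hreg : is_regular e d)
    (nbr : V -> 'I_d -> V) (hnbr : is_indexing e o nbr)
    (rho0 : rotor_config d V) (hrho0 : forall v, dir (rho0 v) = d - 1) :
  every_chip_returns nbr o rho0.
Proof.
have [sym_e irr_e _] := hT.
apply: (origin_state_recurrent (ltnW hd) sym_e irr_e hnbr) => i.
by exists 0 => s _; rewrite hrho0 subn1.
Qed.
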